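(* Let $X$ be a finite bikei, $A$ an abelian group and $\phi\in H^2_{BK}(X;A)$. If $D$ and $D'$ are unoriented knot or link diagrams related by Reidemeister moves, then $$\Phi^{\phi,M}_X(D)=\Phi^{\phi,M}_X(D')\quad\text{and}\quad \Phi^{\phi}_X(D)=\Phi^{\phi}_X(D').$$
   Context: A bikei is a set $X$ with two binary operations $\underline{\ast},\overline{\ast}:X\times X\to X$ such that for all $x,y,z\in X$: (i) $x\,\underline{\ast}\,x=x\,\overline{\ast}\,x$; (ii) $(x\,\overline{\ast}\,y)\,\overline{\ast}\,y=x$, $(x\,\underline{\ast}\,y)\,\underline{\ast}\,y=x$, $x\,\underline{\ast}\,(y\,\overline{\ast}\,x)=x\,\underline{\ast}\,y$, $x\,\overline{\ast}\,(y\,\underline{\ast}\,x)=x\,\overline{\ast}\,y$; (iii) (exchange laws) $(x\,\overline{\ast}\,y)\,\overline{\ast}\,(z\,\overline{\ast}\,y)=(x\,\overline{\ast}\,z)\,\overline{\ast}\,(y\,\underline{\ast}\,z)$, $(x\,\underline{\ast}\,y)\,\overline{\ast}\,(z\,\underline{\ast}\,y)=(x\,\overline{\ast}\,z)\,\underline{\ast}\,(y\,\overline{\ast}\,z)$, $(x\,\underline{\ast}\,y)\,\underline{\ast}\,(z\,\underline{\ast}\,y)=(x\,\underline{\ast}\,z)\,\underline{\ast}\,(y\,\overline{\ast}\,z)$. A bikei homomorphism is a map preserving both operations. Bikei cohomology. For an abelian group $A$, set $C_n(X;A)=A[X^n]$ for $n\ge 1$, and $C_n(X;A)=\{0\}$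 otherwise. The boundary map $\partial_n:C_n(X;A)\to C_{n-1}(X;A)$ is the linear extension of $$\partial_n(x_1,\dots,x_n)=\sum_{k=1}^n(-1)^{k-1}\left(\partial^1_k(x_1,\dots,x_n)-\partial^2_k(x_1,\dots,x_n)\right),$$ where $\partial^1_k(x_1,\dots,x_n)=(x_1,\dots,x_{k-1},x_{k+1},\dots,x_n)$ and $\partial^2_k(x_1,\dots,x_n)=(x_1\,\underline{\ast}\,x_k,\dots,x_{k-1}\,\underline{\ast}\,x_k,x_{k+1}\,\overline{\ast}\,x_k,\dots,x_n\,\overline{\ast}\,x_k)$ for $n\geq2$; $\partial_1=0$. The bikei degenerate subcomplex $C^{BD}_n(X;A)$ is generated by all $A$-multiples of: for $n=1$, $(x)-(x\,\underline{\ast}\,y)$ and $(x)-(x\,\overline{\ast}\,y)$; for $n=2$, $(x,x)$, $(x,y)-(x\,\underline{\ast}\,y,\,y\,\overline{\ast}\,x)$, $(x,y)+(x,\,y\,\overline{\ast}\,x)$ and $(x,y)+(x\,\underline{\ast}\,y,\,y)$; for $n\ge 3$, all $(x_1,\dots,x_n)$ with $x_j=x_{j+1}$ for some $j$. Put $C^{BK}_n=C_n/C^{BD}_n$. Then $H^n_{BK}(X;A)=\mathrm{Ker}\,\delta^{n+1}/\mathrm{Im}\,\delta^n$, where $\delta^n\phi=\phi\circ\partial_n$ and degree-$n$ cochains are homomorphisms $C^{BK}_n(X;\mathbb{Z})\to A$. An element of $H^2_{BK}(X;A)$ and a 2-cocycle representing it, viewed as a function $\phi:X\times X\to A$, are denoted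 by the same symbol. Diagrams and colorings. The semiarcs of an unoriented link diagram $D$ are the portions of $D$ obtained by cutting at every crossing point, on both the over- and the under-strand (a crossingless component is one semiarc). At each crossing, place the crossing by a planar rotation so that the overstrand runs from upper right to lower left and the understrand from upper left to lower right. If $x$ is the upper-left (under) semiarc and $y$ is the upper-right (over) semiarc, the crossing relations are: the lower-right (under) semiarc is $x\,\underline{\ast}\,y$ and the lower-left (over) semiarc is $y\,\overline{\ast}\,x$. (Rotating by $180^\circ$ gives equivalent relations by the bikei axioms.) The fundamental bikei $\mathcal{BK}(D)$ is the bikei generated by the semiarcs of $D$ subject to the crossing relations, i.e. the set of bikei words in the semiarcs modulo the equivalence relation generated by the bikei axioms and the crossing relations. A homomorphism $f:\mathcal{BK}(D)\to X$ is the same as an assignment of elements of $X$ to the semiarcs satisfying all crossing relations; $D_f$ denotes $D$ with the semiarcs so labeled. Invariants. For $f\in\mathrm{Hom}(\mathcal{BK}(D),X)$, the Boltzmann weight of a crossing, placed by a planar rotation so that the overstrand runs from upper right to lower left and the understrand from upper left to lower right, is $\phi(x,y)$, where $x$ and $y$ are the colors of the under and over semiarcs (upper left and upper right respectively). The Boltzmann weight $BW(D_f)\in A$ is the sum of the weights over all crossings of $D_f$. Define the multiset $\Phi^{\phi,M}_X(D)=\{BW(D_f)\mid f\in\mathrm{Hom}(\mathcal{BK}(D),X)\}$ and the formal sum $\Phi^{\phi}_X(D)=\sum_{f\in\mathrm{Hom}(\mathcal{BK}(D),X)}u^{BW(D_f)}$, where $u$ is a dummy variable with formal exponents in $A$.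 *)

(* Defs.v *)
From HB Require Import structures.
From Stdlib Require Import Relation_Operators.
From mathcomp Require Import all_boot all_order all_algebra.
From mathcomp Require Import finmap multiset monalg boolp.

Set Implicit Arguments.
Unset Strict Implicit.
Unset Printing Implicit Defensive.

Import GRing.Theory.
Local Open Scope ring_scope.
Local Open Scope quotient_scope.

(** * Bikei *)

HB.mixin Record isBikei X := {
  under : X -> X -> X;
  over : X -> X -> X;
  bikei_diag : forall x, under x x = over x x;
  overK : forall x y, over (over x y) y = x;
  underK : forall x y, under (under x y) y = x;
  under_over : forall x y, under x (over y x) = under x y;
  over_under : forall x y, over x (under y x) = over x y;
  over_over_exchange : forall x y z,
    over (over x y) (over z y) = over (over x z) (under y z);
  under_over_exchange : forall x y z,
    over (under x y) (under z y) = under (over x z) (over y z);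
  under_under_exchange : forall x y z,
    under (under x y) (under z y) = under (under x z) (over y z)
}.

#[short(type="bikeiType")]
HB.structure Definition Bikei := { X of isBikei X }.

#[short(type="finBikeiType")]
HB.structure Definition FinBikei := { X of isBikei X & Finite X }.

Definition bikei_hom (X Y : bikeiType) (f : X -> Y) : Prop :=
  (forall x y, f (under x y) = under (f x) (f y)) /\
  (forall x y, f (over x y) = over (f x) (f y)).

(** * Bikei cohomology *)

Inductive zspan (V : zmodType) (G : V -> Prop) : V -> Prop :=
| zspan_gen v : G v -> zspan G v
| zspan0 : zspan G 0
| zspanB u v : zspan G u -> zspan G v -> zspan G (u - v).

Section Cohomology.
Variable X : finBikeiType.

Definition cell (n : nat) : choiceType :=
  if n is 0%N then void else n.-tuple X.

(* C_n(X;Z); the cochains below only involve integral chains. *)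
Definition chain (n : nat) := {malg int[cell n]}.

(* The entries of a tuple are numbered from 0, so position k of the code is
   position k+1 of the usual formula and its sign is (-1)^k.               *)
Definition face1 n (k : 'I_n.+1) (t : n.+1.-tuple X) : n.-tuple X :=
  [tuple tnth t (lift k i) | i < n].

Definition face2 n (k : 'I_n.+1) (t : n.+1.-tuple X) : n.-tuple X :=
  [tuple if (i < k)%N then under (tnth t (lift k i)) (tnth t k)
         else over (tnth t (lift k i)) (tnth t k) | i < n].

Definition gen n (t : n.+1.-tuple X) : chain n.+1 := << (t : cell n.+1) >>.

Definition boundary_cell n (t : n.+2.-tuple X) : chain n.+1 :=
  \sum_(k < n.+2) (gen (face1 k t) - gen (face2 k t)) *~ (-1) ^+ k.

Definition boundary (n : nat) : chain n -> chain n.-1 :=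
  match n with
  | m.+2 => fun c : chain m.+2 =>
      \sum_(t <- msupp c) boundary_cell (t : m.+2.-tuple X) *~ c@_t
  | _ => fun=> 0
  end.

Definition degenerate_gen (n : nat) : chain n -> Prop :=
  match n with
  | 0 => fun=> False
  | 1 => fun c : chain 1 => exists x y : X,
      c = gen [tuple x] - gen [tuple under x y] \/
      c = gen [tuple x] - gen [tuple over x y]
  | 2 => fun c : chain 2 => exists x y : X,
      [\/ c = gen [tuple x; x],
          c = gen [tuple x; y] - gen [tuple under x y; over y x],
          c = gen [tuple x; y] + gen [tuple x; over y x] |
          c = gen [tuple x; y] + gen [tuple under x y; y] ]
  | m.+3 => fun c : chain m.+3 => exists t : m.+3.-tuple X,
      (exists2 j : 'I_m.+2,
         tnth t (widen_ord (leqnSn _) j) = tnth t (lift ord0 j) &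
         c = gen t)
  end.

Definition CBD (n : nat) : {pred chain n} :=
  fun c => `[< zspan (@degenerate_gen n) c >].

Lemma CBD_zmod_closed n : zmod_closed (@CBD n).
Proof.
split=> [|u v /asboolP hu /asboolP hv]; apply/asboolP; first exact: zspan0.
exact: zspanB.
Qed.

HB.instance Definition _ n :=
  GRing.isZmodClosed.Build (chain n) (@CBD n) (@CBD_zmod_closed n).

Definition CBK (n : nat) : zmodType := Quotient.quot (@CBD n).

Definition bk_class n (c : chain n) : CBK n := \pi_(Quotient.quot (@CBD n)) c.

Lemma bk_class_zmod_morphism n : zmod_morphism (@bk_class n).
Proof. by move=> c d; rewrite /bk_class raddfB. Qed.

HB.instance Definition _ n :=
  GRing.isZmodMorphism.Build (chain n) (CBK n) (@bk_class n)
    (@bk_class_zmod_morphism n).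

Variable A : zmodType.

Definition cochain (n : nat) := {additive CBK n -> A}.

(* delta^n psi = psi o boundary_n, evaluated on representatives in C_n(X;Z);
   no loss for cocycles and coboundaries, as C_n(X;Z) -> CBK n is onto.      *)
Definition delta n (psi : cochain n.-1) (c : chain n) : A :=
  psi (bk_class (boundary c)).

Definition cocycle n (phi : cochain n) : Prop :=
  forall c : chain n.+1, @delta n.+1 phi c = 0.

Definition coboundary n (phi : CBK n -> A) : Prop :=
  exists psi : cochain n.-1, forall c : chain n, phi (bk_class c) = delta psi c.

(* H^n_BK(X;A): an element of Ker delta^(n+1) / Im delta^n is a coset. *)
Definition cohomology (n : nat) :=
  {h : cochain n -> Prop | exists2 z : cochain n, cocycle z &
     forall z' : cochain n, h z' <-> coboundary (fun c => z' c - z c)}.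

Definition represents n (phi : cochain n) (h : cohomology n) : Prop :=
  sval h phi.

Definition cochain2_fun (phi : cochain 2) (x y : X) : A :=
  phi (bk_class (gen [tuple x; y])).

End Cohomology.

(** * Unoriented link diagrams *)

(* Planar diagram codes, possibly with m loose ends [bpt].  [slot c k], k = 0,
   1, 2, 3, are the semiarcs met going counterclockwise around the crossing c,
   starting from an end of the understrand:

        0     3
         \   /        under: slot 0 -- slot 2
          \ /
           /          over:  slot 3 -- slot 1
          / \
         /   \
        1     2

   Starting from the other end of the understrand shifts k by 2.            *)
Record pretangle (m : nat) := Pretangle {
  semiarc : finType;
  xing : finType;
  slot : xing -> 'I_4 -> semiarc;
  bpt : 'I_m -> semiarc
}.
Arguments slot {m} T c k : rename.
Arguments bpt {m} T i : rename.

Definition endpoint m (T : pretangle m) : finType :=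
  ((xing T * 'I_4) + 'I_m)%type.

Definition semiarc_at m (T : pretangle m) (e : endpoint T) : semiarc T :=
  match e with inl d => slot T d.1 d.2 | inr i => bpt T i end.

(* A semiarc has two ends, or none if it is a crossingless component. *)
Definition is_tangle m (T : pretangle m) : Prop :=
  forall a : semiarc T, #|[set e : endpoint T | semiarc_at e == a]| \in [:: 0%N; 2].

Section Planarity.
Variable D : pretangle 0.

Definition dart : finType := (xing D * 'I_4)%type.

Definition opposite (d : dart) : dart :=
  odflt d [pick d' : dart | (d' != d) && (slot D d'.1 d'.2 == slot D d.1 d.2)].

Definition next_on_region (d : dart) : dart :=
  let d' := opposite d in (d'.1, d'.2 + 1).

Definition adjacent (c c' : xing D) : bool :=
  [exists k, exists k', slot D c k == slot D c' k'].

(* Euler's formula V - E + F = 2 C for the 4-valent graph of the crossings, in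
   which E = 2 V: each of its C connected components lies on a sphere.  The
   crossingless components impose no condition.  A code records neither the
   unbounded region nor how the connected components are nested, data on which
   the fundamental bikei and the Boltzmann weights do not depend; codes of
   diagrams related by a Reidemeister move or by planar isotopy are related by
   [reidemeister_move] below.                                               *)
Definition planar : Prop :=
  fcard next_on_region predT =
    (#|xing D| + 2 * n_comp adjacent predT)%N.

End Planarity.

Record link_diagram := LinkDiagram {
  code :> pretangle 0;
  code_is_tangle : is_tangle code;
  code_planar : planar code
}.

(** * Reidemeister moves *)

Section Gluing.
Variables (m : nat) (P Q : pretangle m).

Definition sum_slot (c : xing P + xing Q) (k : 'I_4) : semiarc P + semiarc Q :=
  match c with inl c => inl (slot P c k) | inr c => inr (slot Q c k) end.

Definition joined (a b : semiarc P + semiarc Q) : bool :=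
  [exists i, ((a == inl (bpt P i)) && (b == inr (bpt Q i))) ||
             ((b == inl (bpt P i)) && (a == inr (bpt Q i)))].

(* D is obtained from P and Q by joining the i-th loose end of P to the i-th
   loose end of Q, up to renaming semiarcs and crossings and up to the choice
   of the first understrand end of each crossing.                           *)
Definition glues_to (D : pretangle 0) : Prop :=
  exists (gx : xing P + xing Q -> xing D) (ga : semiarc P + semiarc Q -> semiarc D),
    [/\ bijective gx,
        (forall a, exists b, ga b = a),
        (forall a b, (ga a == ga b) = connect joined a b) &
        forall c, exists2 r : 'I_4, (r == 0) || (r == inord 2) &
          forall k, slot D (gx c) (k + r) = ga (sum_slot c k)].

End Gluing.

(* The semiarcs are 0, ..., n; [cs] lists the four slots of each crossing and
   [bs] the semiarcs at the loose ends.                                     *)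
Definition pd (n : nat) (cs : seq (seq nat)) (bs : seq nat) :
    pretangle (size bs) :=
  @Pretangle (size bs) 'I_n.+1 'I_(size cs)
    (fun c k => inord (nth 0%N (nth [::] cs c) k))
    (fun i => inord (nth 0%N bs i)).

Definition empty_tangle : pretangle 0 :=
  @Pretangle 0 void void (fun c _ => c) (fun i => match ltn_ord i : false with end).

(* One strand, and the two kinks. *)
Definition R1_strand := (pd 0 [::] [:: 0; 0])%N.
Definition R1_kink := (pd 2 [:: [:: 1; 1; 2; 0]] [:: 0; 2])%N.
Definition R1_kink' := (pd 2 [:: [:: 0; 1; 1; 2]] [:: 0; 2])%N.

(* Two vertical strands; the left one runs 0, 1, 2 upwards and is pushed over
   the right one, which runs 3, 4, 5 upwards.                               *)
Definition R2_parallel := (pd 1 [::] [:: 0; 0; 1; 1])%N.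
Definition R2_bigon := (pd 5 [:: [:: 4; 0; 3; 1]; [:: 4; 1; 5; 2]] [:: 0; 2; 3; 5])%N.

(* A horizontal strand 0, 1, 2 (left to right) passes over the strands
   3, 4, 5 (lower left to upper right) and 6, 7, 8 (lower right to upper left),
   above or below the point where these two cross; there the former strand is
   over the latter, or under it in the primed version.  The loose ends are listed
   counterclockwise from the right end of the horizontal strand.              *)
Definition R3_ends : seq nat := [:: 2; 5; 8; 0; 3; 6]%N.
Definition R3_above :=
  (pd 8 [:: [:: 7; 3; 6; 4]; [:: 8; 0; 7; 1]; [:: 5; 1; 4; 2]] R3_ends)%N.
Definition R3_below :=
  (pd 8 [:: [:: 8; 4; 7; 5]; [:: 4; 0; 3; 1]; [:: 7; 1; 6; 2]] R3_ends)%N.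
Definition R3_above' :=
  (pd 8 [:: [:: 3; 6; 4; 7]; [:: 8; 0; 7; 1]; [:: 5; 1; 4; 2]] R3_ends)%N.
Definition R3_below' :=
  (pd 8 [:: [:: 4; 7; 5; 8]; [:: 4; 0; 3; 1]; [:: 7; 1; 6; 2]] R3_ends)%N.

(* Replacing the empty tangle by itself only relabels the diagram, which
   accounts for planar isotopy.                                             *)
Inductive local_move : forall m, pretangle m -> pretangle m -> Prop :=
| move_R0 : local_move empty_tangle empty_tangle
| move_R1 : local_move R1_strand R1_kink
| move_R1' : local_move R1_strand R1_kink'
| move_R2 : local_move R2_parallel R2_bigon
| move_R3 : local_move R3_above R3_below
| move_R3' : local_move R3_above' R3_below'.

(* The complement Q of the disc of the move is not required to be planar by
   itself: both diagrams being planar forces the two strands of an R2 move to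
   border a common region, or to lie in different connected components.     *)
Definition reidemeister_move (D D' : link_diagram) : Prop :=
  exists (m : nat) (L R Q : pretangle m),
    [/\ local_move L R, is_tangle Q, glues_to L Q D & glues_to R Q D'].

Definition reidemeister_equivalent : link_diagram -> link_diagram -> Prop :=
  clos_refl_sym_trans link_diagram reidemeister_move.

(** * The fundamental bikei *)

Inductive word (S : Type) : Type :=
| Gen of S
| Under of word S & word S
| Over of word S & word S.

HB.instance Definition _ (S : Type) := gen_eqMixin (word S).
HB.instance Definition _ (S : Type) := gen_choiceMixin (word S).

Section FundamentalBikei.
Variable D : pretangle 0.

Inductive word_eq : word (semiarc D) -> word (semiarc D) -> Prop :=
| weq_refl u : word_eq u u
| weq_sym u v : word_eq u v -> word_eq v u
| weq_trans u v w : word_eq u v -> word_eq v w -> word_eq u w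
| weq_Under u u' v v' :
    word_eq u u' -> word_eq v v' -> word_eq (Under u v) (Under u' v')
| weq_Over u u' v v' :
    word_eq u u' -> word_eq v v' -> word_eq (Over u v) (Over u' v')
| weq_diag u : word_eq (Under u u) (Over u u)
| weq_overK u v : word_eq (Over (Over u v) v) u
| weq_underK u v : word_eq (Under (Under u v) v) u
| weq_under_over u v : word_eq (Under u (Over v u)) (Under u v)
| weq_over_under u v : word_eq (Over u (Under v u)) (Over u v)
| weq_over_over_exchange u v w :
    word_eq (Over (Over u v) (Over w v)) (Over (Over u w) (Under v w))
| weq_under_over_exchange u v w :
    word_eq (Over (Under u v) (Under w v)) (Under (Over u w) (Over v w))
| weq_under_under_exchange u v w :
    word_eq (Under (Under u v) (Under w v)) (Under (Under u w) (Over v w))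
| weq_crossing_under (c : xing D) :
    word_eq (Gen (slot D c (inord 2)))
            (Under (Gen (slot D c (inord 0))) (Gen (slot D c (inord 3))))
| weq_crossing_over (c : xing D) :
    word_eq (Gen (slot D c (inord 1)))
            (Over (Gen (slot D c (inord 3))) (Gen (slot D c (inord 0)))).

Definition word_eqb (u v : word (semiarc D)) : bool := `[< word_eq u v >].

Lemma word_eqb_equiv : equiv_class_of word_eqb.
Proof.
split=> [u|u v|v u w]; first by apply/asboolP; apply: weq_refl.
  by apply/asboolP/asboolP; apply: weq_sym.
by move=> /asboolP uv /asboolP vw; apply/asboolP; apply: weq_trans uv vw.
Qed.

Canonical word_equiv_rel := EquivRelPack word_eqb_equiv.
Canonical word_encModRel := defaultEncModRel word_eqb.

Definition BK := {eq_quot word_eqb}.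

Lemma BK_eqP u v : word_eq u v <-> \pi_BK u = \pi_BK v.
Proof.
split=> [/asboolP uv|/eqmodP/asboolP //].
by apply/eqmodP.
Qed.

Lemma word_eq_repr u : word_eq (repr (\pi_BK u)) u.
Proof. by apply/BK_eqP; rewrite reprK. Qed.

Definition BK_under (p q : BK) : BK := \pi_BK (Under (repr p) (repr q)).
Definition BK_over (p q : BK) : BK := \pi_BK (Over (repr p) (repr q)).

Lemma pi_Under u v : BK_under (\pi_BK u) (\pi_BK v) = \pi_BK (Under u v).
Proof. by apply/BK_eqP; apply: weq_Under; apply: word_eq_repr. Qed.

Lemma pi_Over u v : BK_over (\pi_BK u) (\pi_BK v) = \pi_BK (Over u v).
Proof. by apply/BK_eqP; apply: weq_Over; apply: word_eq_repr. Qed.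

Lemma BK_diag p :
  BK_under p p = BK_over p p.
Proof.
elim/quotW: p => u.
rewrite pi_Under pi_Over.
by apply/BK_eqP; apply: weq_diag.
Qed.

Lemma BK_overK p q :
  BK_over (BK_over p q) q = p.
Proof.
elim/quotW: p => u; elim/quotW: q => v.
rewrite (pi_Over u v) pi_Over.
by apply/BK_eqP; apply: weq_overK.
Qed.

Lemma BK_underK p q :
  BK_under (BK_under p q) q = p.
Proof.
elim/quotW: p => u; elim/quotW: q => v.
rewrite (pi_Under u v) pi_Under.
by apply/BK_eqP; apply: weq_underK.
Qed.

Lemma BK_under_over p q :
  BK_under p (BK_over q p) = BK_under p q.
Proof.
elim/quotW: p => u; elim/quotW: q => v.
rewrite (pi_Over v u) !pi_Under.
by apply/BK_eqP; apply: weq_under_over.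
Qed.

Lemma BK_over_under p q :
  BK_over p (BK_under q p) = BK_over p q.
Proof.
elim/quotW: p => u; elim/quotW: q => v.
rewrite (pi_Under v u) !pi_Over.
by apply/BK_eqP; apply: weq_over_under.
Qed.

Lemma BK_over_over_exchange p q r :
  BK_over (BK_over p q) (BK_over r q) = BK_over (BK_over p r) (BK_under q r).
Proof.
elim/quotW: p => u; elim/quotW: q => v; elim/quotW: r => w.
rewrite (pi_Over u v) (pi_Over w v) (pi_Over u w) (pi_Under v w) !pi_Over.
by apply/BK_eqP; apply: weq_over_over_exchange.
Qed.

Lemma BK_under_over_exchange p q r :
  BK_over (BK_under p q) (BK_under r q) = BK_under (BK_over p r) (BK_over q r).
Proof.
elim/quotW: p => u; elim/quotW: q => v; elim/quotW: r => w.
rewrite (pi_Under u v) (pi_Under w v) (pi_Over u w) (pi_Over v w) pi_Over pi_Under.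
by apply/BK_eqP; apply: weq_under_over_exchange.
Qed.

Lemma BK_under_under_exchange p q r :
  BK_under (BK_under p q) (BK_under r q) =
  BK_under (BK_under p r) (BK_over q r).
Proof.
elim/quotW: p => u; elim/quotW: q => v; elim/quotW: r => w.
rewrite (pi_Under u v) (pi_Under w v) (pi_Under u w) (pi_Over v w) !pi_Under.
by apply/BK_eqP; apply: weq_under_under_exchange.
Qed.

HB.instance Definition _ := isBikei.Build BK BK_diag BK_overK BK_underK
  BK_under_over BK_over_under BK_over_over_exchange BK_under_over_exchange
  BK_under_under_exchange.

Definition semiarc_gen (a : semiarc D) : BK := \pi_BK (Gen a).

End FundamentalBikei.

(** * Colorings and the Boltzmann weight *)

Section Invariants.
Variable X : finBikeiType.

Record Hom (D : pretangle 0) := MkHom {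
  hom_fun :> BK D -> X;
  hom_funP : bikei_hom hom_fun
}.

(* The label of a semiarc in D_f. *)
Definition label D (f : Hom D) (a : semiarc D) : X := f (semiarc_gen a).

Lemma label_inj D (f g : Hom D) : label f =1 label g -> f = g.
Proof.
case: f g => [f hf] [g hg] /= fg; suff e : f = g.
  by case: _ / e in hg fg *; rewrite (Prop_irrelevance hf hg).
apply: funext => p; elim/quotW: p => u.
elim: u => [a|u IHu v IHv|u IHu v IHv]; first exact: fg.
  by rewrite -pi_Under (hf.1 (\pi u) (\pi v)) (hg.1 (\pi u) (\pi v)) IHu IHv.
by rewrite -pi_Over (hf.2 (\pi u) (\pi v)) (hg.2 (\pi u) (\pi v)) IHu IHv.
Qed.

Definition hom_code D (f : Hom D) : {ffun semiarc D -> X} := [ffun a => label f a].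

Definition hom_decode D (c : {ffun semiarc D -> X}) : option (Hom D) :=
  if pselect (exists f : Hom D, hom_code f = c) is left e
  then Some (sval (cid e)) else None.

Lemma hom_codeK D : pcancel (@hom_code D) (@hom_decode D).
Proof.
move=> f; rewrite /hom_decode; case: pselect => [e|]; last by case; exists f.
congr Some; apply: label_inj => a; case: cid => g /= /ffunP /(_ a).
by rewrite !ffunE.
Qed.

HB.instance Definition _ D := Finite.copy (Hom D) (pcan_type (@hom_codeK D)).

Variables (A : zmodType) (phi : cochain X A 2).

Definition BW D (f : Hom D) : A :=
  \sum_(c : xing D)
    cochain2_fun phi (label f (slot D c (inord 0))) (label f (slot D c (inord 3))).

Definition Phi_multiset (D : pretangle 0) : multiset A :=
  seq_mset [seq BW f | f : Hom D].

(* The exponential u^a is the generator << a >> of the free Z-module on A. *)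
Definition Phi_sum (D : pretangle 0) : {malg int[A]} :=
  \sum_(f : Hom D) << BW f >>.

End Invariants.

(* Main.v *)
(* Call the colors of the loose ends of a tangle its boundary.  Both sides of each local move are
   rigid (a coloring is determined by its boundary), and every coloring of one side shares its
   boundary and its total Boltzmann weight with a coloring of the other side.  Gluing the same outer
   tangle to both sides then gives injections in both directions between the colorings of the two
   diagrams, one of which preserves the Boltzmann weight.
   The weights agree for R1 and R2 because phi vanishes on degenerate chains.  For R3 with incoming
   colors x, y, z they agree by the cocycle condition at (x, y, over z y) or (y, x, over z y),
   depending on the crossing of the two lower strands.
   A representative of a class in H^2 is a cocycle without computing the square of the boundary:
   degree-2 coboundaries vanish, the boundary of a pair being degenerate. *)

Require Import Defs.
From mathcomp Require Import all_boot all_order all_algebra.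
From mathcomp Require Import finmap multiset monalg boolp.

Set Implicit Arguments.
Unset Strict Implicit.
Unset Printing Implicit Defensive.

(* Re-importing [Defs] unshadows [over], which ssreflect also defines. *)
Import GRing.Theory Defs.
Local Open Scope ring_scope.

(** * Bikei identities behind the half turn of a crossing and the R3 moves *)

Section BikeiTheory.
Variable X : bikeiType.
Implicit Types x y z : X.

(** With [over_pairK], this makes [(x, y) -> (under x y, over y x)] an involution, which is why a
    crossing can be read from either end of its understrand. *)
Lemma under_pairK x y : under (under x y) (over y x) = x.
Proof. by rewrite -(over_under y x) under_over underK. Qed.

Lemma over_pairK x y : over (over y x) (under x y) = y.
Proof. by rewrite -(under_over x y) over_under overK. Qed.

Lemma crossing_half_turn x y s t :
  t = under s x -> y = over x s -> s = under t y /\ x = over y t.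
Proof. by move=> -> ->; rewrite under_pairK over_pairK. Qed.

(** The unprimed [swap] lemmas compare the outgoing colors of the top, bottom and middle strands of
    [R3_above] and [R3_below], for incoming colors [x], [y], [z] at arcs 8, 5, 2; the primed ones do
    so for the primed codes. *)
Lemma over_over_swap x y z :
  over (over z (under x y)) (over y x) = over (over z y) x.
Proof.
by rewrite -[in over y x](over_under y x) over_over_exchange underK.
Qed.

Lemma over_over_swap' x y z :
  over (over z (over x y)) (under y x) = over (over z y) x.
Proof.
by rewrite -(under_over y x) -over_over_exchange overK.
Qed.

Lemma under_under_swap x y z :
  under (under x (over z y)) (under y z) = under (under x y) z.
Proof. by rewrite -(under_over y z) under_under_exchange overK. Qed.

Lemma over_under_swap x y z :
  over (under y z) (under x (over z y)) = under (over y x) (over z (under x y)).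
Proof.
(* The exchange law acts by [over z y]: it takes [under y z] back to [y] and [under x (over z y)]
   back to [x]. *)
have e : over y x = under (over (under y z) (under x (over z y)))
                          (over (over z y) (under x (over z y))).
  by rewrite -under_over_exchange under_pairK underK.
by rewrite -(under_over (over y x)) over_over_swap {1}e over_under underK.
Qed.

Lemma under_under_swap' x y z :
  under (under y z) (under x (over z y)) = under (under y x) (over z (over x y)).
Proof.
rewrite -(under_over (under y x)) over_over_swap'.
by rewrite -under_under_exchange under_over.
Qed.

Lemma over_under_swap' x y z :
  over (under x (over z y)) (under y z) = under (over x y) z.
Proof. by rewrite -(under_over y z) under_over_exchange overK. Qed.

End BikeiTheory.

(** * Values of a 2-cocycle: degenerate pairs and the R3 identities *)

Lemma alternating_sum2 (V : zmodType) (F : 'I_2 -> V) :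
  \sum_(k < 2) F k *~ (-1) ^+ k = F ord0 - F (lift ord0 ord0).
Proof. by rewrite !big_ord_recl big_ord0 /= mulr1z mulrN1z addr0. Qed.

Lemma alternating_sum3 (V : zmodType) (F : 'I_3 -> V) :
  \sum_(k < 3) F k *~ (-1) ^+ k =
  F ord0 - F (lift ord0 ord0) + F (lift ord0 (lift ord0 ord0)).
Proof. by rewrite !big_ord_recl big_ord0 /= !mulr1z mulrN1z addr0 addrA. Qed.

Section CocycleIdentities.
Variables (X : finBikeiType) (A : zmodType).

Lemma bk_class_eq0 n (c : chain X n) : degenerate_gen c -> bk_class c = 0.
Proof.
move=> hc; rewrite -[RHS](raddf0 (@bk_class X n)); apply/eqmodP.
by rewrite /= Quotient.equivE subr0; apply/asboolP/zspan_gen.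
Qed.

Lemma boundary_gen n (t : n.+2.-tuple X) :
  boundary (gen t) = boundary_cell t.
Proof.
rewrite /boundary /gen msuppU oner_eq0 big_seq_fset1 mcoeffUU.
by rewrite mulr1z.
Qed.

Lemma boundary_pair (x y : X) :
  boundary_cell [tuple x; y] =
  (gen [tuple y] - gen [tuple over y x]) - (gen [tuple x] - gen [tuple under x y]).
Proof.
have f1 : face1 ord0 [tuple x; y] = [tuple y].
  by apply: eq_from_tnth => i; rewrite tnth_mktuple !(tnth_nth x) (ord1 i).
have f2 : face2 ord0 [tuple x; y] = [tuple over y x].
  by apply: eq_from_tnth => i; rewrite tnth_mktuple !(tnth_nth x) (ord1 i).
have f3 : face1 (lift ord0 ord0) [tuple x; y] = [tuple x].
  by apply: eq_from_tnth => i; rewrite tnth_mktuple !(tnth_nth x) (ord1 i).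
have f4 : face2 (lift ord0 ord0) [tuple x; y] = [tuple under x y].
  by apply: eq_from_tnth => i; rewrite tnth_mktuple !(tnth_nth x) (ord1 i).
by rewrite /boundary_cell alternating_sum2 f1 f2 f3 f4.
Qed.

Lemma boundary_triple (x y z : X) :
  boundary_cell [tuple x; y; z] =
  (gen [tuple y; z] - gen [tuple over y x; over z x]) -
  (gen [tuple x; z] - gen [tuple under x y; over z y]) +
  (gen [tuple x; y] - gen [tuple under x z; under y z]).
Proof.
have f1 : face1 ord0 [tuple x; y; z] = [tuple y; z].
  by apply: eq_from_tnth => -[[|[|i]] hi] //; rewrite tnth_mktuple !(tnth_nth x).
have f2 : face2 ord0 [tuple x; y; z] = [tuple over y x; over z x].
  by apply: eq_from_tnth => -[[|[|i]] hi] //; rewrite tnth_mktuple !(tnth_nth x).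
have f3 : face1 (lift ord0 ord0) [tuple x; y; z] = [tuple x; z].
  by apply: eq_from_tnth => -[[|[|i]] hi] //; rewrite tnth_mktuple !(tnth_nth x).
have f4 : face2 (lift ord0 ord0) [tuple x; y; z] = [tuple under x y; over z y].
  by apply: eq_from_tnth => -[[|[|i]] hi] //; rewrite tnth_mktuple !(tnth_nth x).
have f5 : face1 (lift ord0 (lift ord0 ord0)) [tuple x; y; z] = [tuple x; y].
  by apply: eq_from_tnth => -[[|[|i]] hi] //; rewrite tnth_mktuple !(tnth_nth x).
have f6 : face2 (lift ord0 (lift ord0 ord0)) [tuple x; y; z] =
    [tuple under x z; under y z].
  by apply: eq_from_tnth => -[[|[|i]] hi] //; rewrite tnth_mktuple !(tnth_nth x).
by rewrite /boundary_cell alternating_sum3 f1 f2 f3 f4 f5 f6.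
Qed.

Lemma bk_boundary2 (c : chain X 2) : bk_class (boundary c) = 0.
Proof.
rewrite /boundary raddf_sum big1 // => t _; rewrite raddfMz.
case/tupleP: t => x t; case/tupleP: t => y t; rewrite (tuple0 t).
have e1 : bk_class (gen [tuple y] - gen [tuple over y x]) = 0.
  by apply: bk_class_eq0; exists y, x; right.
have e2 : bk_class (gen [tuple x] - gen [tuple under x y]) = 0.
  by apply: bk_class_eq0; exists x, y; left.
rewrite (boundary_pair x y) raddfB [X in X - _]e1 [X in _ - X]e2 subr0.
by rewrite mul0rz.
Qed.

Variables (h : cohomology X A 2) (phi : cochain X A 2).

Lemma represents_cocycle : represents phi h -> cocycle phi.
Proof.
case: h => P [z hz hP] /= /hP [psi e] c; apply/eqP.
have := e (boundary c); rewrite /delta bk_boundary2 raddf0 => /eqP.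
by rewrite subr_eq0 => /eqP ->; apply/eqP/hz.
Qed.

Local Notation f := (cochain2_fun phi).

Let evalB (u v : chain X 2) : phi (bk_class (u - v)) = phi (bk_class u) - phi (bk_class v).
Proof. by rewrite !raddfB. Qed.

Let evalD (u v : chain X 2) : phi (bk_class (u + v)) = phi (bk_class u) + phi (bk_class v).
Proof. by rewrite !raddfD. Qed.

Let eval_degenerate (c : chain X 2) : degenerate_gen c -> phi (bk_class c) = 0.
Proof. by move=> /bk_class_eq0 ->; rewrite raddf0. Qed.

Lemma phi_diag x : f x x = 0.
Proof. by apply: eval_degenerate; exists x, x; constructor 1. Qed.

(** This makes the weight of a crossing independent of the understrand end from which it is read. *)
Lemma phi_pair x y : f (under x y) (over y x) = f x y.
Proof.
apply/esym/eqP; rewrite -subr_eq0 -evalB; apply/eqP/eval_degenerate.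
by exists x, y; constructor 2.
Qed.

Lemma phi_over x y : f x (over y x) = - f x y.
Proof.
apply/esym/eqP; rewrite eqr_oppLR -addr_eq0 -evalD; apply/eqP/eval_degenerate.
by exists x, y; constructor 3.
Qed.

Lemma phi_under x y : f (under x y) y = - f x y.
Proof.
apply/esym/eqP; rewrite eqr_oppLR -addr_eq0 -evalD; apply/eqP/eval_degenerate.
by exists x, y; constructor 4.
Qed.

Hypothesis phi_cocycle : cocycle phi.

Lemma phi_triple x y z :
  f y z + f (under x y) (over z y) + f x y =
  f (over y x) (over z x) + f x z + f (under x z) (under y z).
Proof.
have eval6 (a b c d e g : chain X 2) :
    phi (bk_class (a - b - (c - d) + (e - g))) =
    phi (bk_class a) + phi (bk_class d) + phi (bk_class e)
    - (phi (bk_class b) + phi (bk_class c) + phi (bk_class g)).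
  rewrite evalD !evalB; move: (phi _) (phi _) (phi _) (phi _) (phi _) (phi _) => u v w p q r.
  by rewrite opprB !opprD !addrA [RHS](ACl (1*4*2*5*3*6)%AC).
apply/eqP; rewrite -subr_eq0 -eval6 -boundary_triple -boundary_gen.
by apply/eqP; apply: phi_cocycle.
Qed.

Let transpose_R3 (a b c d e g : A) :
  - a + b + c = - d + e + g -> g + e + a = c + d + b.
Proof.
move=> H; transitivity (- d + e + g + (a + d)).
  by rewrite [RHS](AC (3*2) ((3*2*4)*(5*1)))%AC /= subrr addr0.
by rewrite -H [LHS](AC (3*2) ((3*5*2)*(4*1)))%AC /= subrr addr0.
Qed.

(** The two sides are the total weights of [R3_above] and [R3_below]. The third entry [over z y] of
    the triple is the color of the top strand between its crossings in [R3_above]; the signs coming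
    from [phi_over] are absorbed by moving terms across. *)
Lemma phi_R3 x y z :
  f (under x (over z y)) (under y z) + f x (over z y) + f y z =
  f x y + f (over y x) (over z (under x y)) + f (under x y) z.
Proof.
have := phi_triple x y (over z y).
rewrite overK -over_over_swap !phi_over under_over.
exact: transpose_R3.
Qed.

Let transpose_R3' (a b c d e g : A) :
  e - d + c = b - a + g -> - g + e + a = - c + d + b.
Proof.
move=> H; transitivity (e - d + c + (- g + a + d - c)).
  by rewrite [RHS](AC (3*4) ((4*1*5)*(6*2)*(3*7)))%AC /= !subrr !addr0.
by rewrite H [LHS](AC (3*4) ((7*6*1)*(5*2)*(3*4)))%AC /= !subrr !addr0.
Qed.

(** Here the [y] strand passes under the [x] strand, so the triple starts with [y], [x]. The weights
    of that crossing have the form [f (under s t) t], which [phi_under] turns into [- f s t]. *)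
Lemma phi_R3' x y z :
  f (under (under y z) (under x (over z y))) (under x (over z y))
  + f x (over z y) + f y z =
  f (under y x) x + f (under y x) (over z (over x y)) + f (over x y) z.
Proof.
have := phi_triple y x (over z y).
rewrite overK -over_over_swap' !phi_over !phi_under under_over.
exact: transpose_R3'.
Qed.

End CocycleIdentities.

(** * Colorings of tangles and homomorphisms from the fundamental bikei *)

Section Colorings.
Variable X : finBikeiType.

Definition crossing_rel (s : 'I_4 -> X) : Prop :=
  s (inord 2) = under (s (inord 0)) (s (inord 3)) /\
  s (inord 1) = over (s (inord 3)) (s (inord 0)).

Definition coloring m (T : pretangle m) (l : semiarc T -> X) : Prop :=
  forall c : xing T, crossing_rel (fun k => l (slot T c k)).

Lemma half_turnE :
  ((inord 0 + inord 2)%R = inord 2 :> 'I_4) * ((inord 1 + inord 2)%R = inord 3 :> 'I_4) *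
  ((inord 2 + inord 2)%R = inord 0 :> 'I_4) * ((inord 3 + inord 2)%R = inord 1 :> 'I_4).
Proof. by do !split; apply: val_inj; rewrite /= !inordK. Qed.

Lemma half_turnK (k : 'I_4) : k + inord 2 + inord 2 = k.
Proof.
rewrite -addrA half_turnE (_ : inord 0 = 0) ?addr0 //.
by apply: val_inj; rewrite /= inordK.
Qed.

Lemma crossing_rel_half_turn (s : 'I_4 -> X) :
  crossing_rel s -> crossing_rel (fun k => s (k + inord 2)).
Proof.
rewrite /crossing_rel !half_turnE => -[-> ->].
by rewrite under_pairK over_pairK.
Qed.

Fixpoint eval_word S (l : S -> X) (w : word S) : X :=
  match w with
  | Gen a => l a
  | Under u v => under (eval_word l u) (eval_word l v)
  | Over u v => over (eval_word l u) (eval_word l v)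
  end.

Lemma eval_word_eq (D : pretangle 0) (l : semiarc D -> X) u v :
  coloring l -> word_eq u v -> eval_word l u = eval_word l v.
Proof.
move=> hl; elim=> //=.
- by move=> ? ? ? _ -> _ ->.
- by move=> ? ? ? ? _ -> _ ->.
- by move=> ? ? ? ? _ -> _ ->.
- by move=> ?; apply: bikei_diag.
- by move=> ? ?; apply: overK.
- by move=> ? ?; apply: underK.
- by move=> ? ?; apply: under_over.
- by move=> ? ?; apply: over_under.
- by move=> ? ? ?; apply: over_over_exchange.
- by move=> ? ? ?; apply: under_over_exchange.
- by move=> ? ? ?; apply: under_under_exchange.
- by move=> c; case: (hl c).
- by move=> c; case: (hl c).
Qed.

(** Word evaluation respects [word_eq], so it descends to [BK D]. With [label_coloring],
    homomorphisms from [BK D] are the colorings of [D]. *)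
Lemma coloring_label (D : pretangle 0) (l : semiarc D -> X) :
  coloring l -> exists f : Hom X D, label f =1 l.
Proof.
move=> hl.
have hom : bikei_hom (fun p : BK D => eval_word l (repr p)).
  by split=> p q; rewrite (eval_word_eq hl (word_eq_repr _)).
by exists (MkHom hom) => a; exact: eval_word_eq (word_eq_repr _).
Qed.

Lemma label_coloring (D : pretangle 0) (f : Hom X D) : coloring (label f).
Proof.
move=> c; split; rewrite /label /semiarc_gen.
  rewrite -(hom_funP f).1; congr (f _); rewrite [RHS]pi_Under.
  by apply/BK_eqP; apply: weq_crossing_under.
rewrite -(hom_funP f).2; congr (f _); rewrite [RHS]pi_Over.
by apply/BK_eqP; apply: weq_crossing_over.
Qed.

Variables (A : zmodType) (phi : cochain X A 2).

Definition crossing_weight (s : 'I_4 -> X) : A :=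
  cochain2_fun phi (s (inord 0)) (s (inord 3)).

Lemma crossing_weight_half_turn (s : 'I_4 -> X) :
  crossing_rel s -> crossing_weight (fun k => s (k + inord 2)) = crossing_weight s.
Proof. by rewrite /crossing_weight !half_turnE => -[-> ->]; apply: phi_pair. Qed.

Definition weight m (T : pretangle m) (l : semiarc T -> X) : A :=
  \sum_(c : xing T) crossing_weight (fun k => l (slot T c k)).

Lemma BWE (D : pretangle 0) (f : Hom X D) : BW phi f = weight (label f).
Proof. by []. Qed.

Definition same_boundary m (L R : pretangle m) (l : semiarc L -> X) (r : semiarc R -> X) :=
  forall i, l (bpt L i) = r (bpt R i).

Definition rigid m (T : pretangle m) : Prop :=
  forall l l' : semiarc T -> X,
    coloring l -> coloring l' -> same_boundary l l' -> l =1 l'.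

Definition simulates m (L R : pretangle m) : Prop :=
  forall l : semiarc L -> X, coloring l ->
    exists r : semiarc R -> X,
      [/\ coloring r, same_boundary l r & weight l = weight r].

(** * Colorings and weights of a diagram glued from two tangles *)

Section Gluing.
Variables (m : nat) (P Q : pretangle m) (D : pretangle 0).
Variables (gx : xing P + xing Q -> xing D) (ga : semiarc P + semiarc Q -> semiarc D).
Hypothesis gx_bij : bijective gx.
Hypothesis ga_onto : forall a, exists b, ga b = a.
Hypothesis ga_eq : forall a b, (ga a == ga b) = connect (@joined _ P Q) a b.
Hypothesis ga_slot : forall c, exists2 r : 'I_4, (r == 0) || (r == inord 2) &
  forall k, slot D (gx c) (k + r) = ga (sum_slot c k).

Lemma glue_crossing (l : semiarc D -> X) c :
  crossing_rel (fun k => l (slot D (gx c) k)) <->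
  crossing_rel (fun k => l (ga (sum_slot c k))).
Proof.
have [r hr e] := ga_slot c.
have -> : (fun k => l (ga (sum_slot c k))) = fun k => l (slot D (gx c) (k + r)).
  by apply: funext => k; rewrite e.
case/orP: hr => /eqP ->.
  by have -> : (fun k => l (slot D (gx c) (k + 0))) = fun k => l (slot D (gx c) k)
    by apply: funext => k; rewrite addr0.
split=> [/crossing_rel_half_turn //|/crossing_rel_half_turn].
by under eq_fun do rewrite half_turnK.
Qed.

Lemma glue_crossing_weight (l : semiarc D -> X) c :
  coloring l -> crossing_weight (fun k => l (slot D (gx c) k)) =
  crossing_weight (fun k => l (ga (sum_slot c k))).
Proof.
move=> hl; have [r hr e] := ga_slot c.
have -> : (fun k => l (ga (sum_slot c k))) = fun k => l (slot D (gx c) (k + r)).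
  by apply: funext => k; rewrite e.
case/orP: hr => /eqP ->; first by under [in RHS]eq_fun do rewrite addr0.
exact/esym/(crossing_weight_half_turn (hl (gx c))).
Qed.

Lemma glue_coloring (l : semiarc D -> X) :
  coloring l <-> coloring (fun a => l (ga (inl a))) /\ coloring (fun a => l (ga (inr a))).
Proof.
split=> [hl|[hP hQ] d].
  by split=> c; [apply/(glue_crossing l (inl c))|apply/(glue_crossing l (inr c))].
have [gy gyK gxK] := gx_bij; rewrite -(gxK d); apply/glue_crossing.
by case: (gy d) => c; [apply: hP|apply: hQ].
Qed.

Lemma glue_weight (l : semiarc D -> X) : coloring l ->
  weight l = weight (fun a => l (ga (inl a))) + weight (fun a => l (ga (inr a))).
Proof.
move=> hl; rewrite /weight (reindex gx) /=; last exact: onW_bij.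
rewrite (eq_bigr _ (fun c _ => glue_crossing_weight c hl)).
exact: big_sumType.
Qed.

Lemma glue_boundary (l : semiarc D -> X) :
  same_boundary (fun a : semiarc P => l (ga (inl a))) (fun a : semiarc Q => l (ga (inr a))).
Proof.
move=> i; congr (l _); apply/eqP; rewrite ga_eq; apply/connect1.
by apply/existsP; exists i; rewrite !eqxx.
Qed.

(** The map [ga] presents the semiarcs of [D] as the classes generated by [joined]. Agreement on the
    boundary makes [p] and [q] constant on these classes, so they factor through [ga]. *)
Lemma glue_extend (p : semiarc P -> X) (q : semiarc Q -> X) :
  same_boundary p q -> exists l : semiarc D -> X,
    (forall a, l (ga (inl a)) = p a) /\ (forall a, l (ga (inr a)) = q a).
Proof.
move=> pq; pose u a := match a with inl a => p a | inr a => q a end.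
have u_connect a b : connect (@joined _ P Q) a b -> u a = u b.
  case/connectP=> s hs ->; elim: s a hs => //= c s IHs a /andP[/existsP[i ac] /IHs <-].
  by case/orP: ac => /andP[/eqP -> /eqP ->] /=.
pose sec d := sval (cid (ga_onto d)); exists (fun d => u (sec d)).
have h a : u (sec (ga a)) = u a.
  by apply: u_connect; rewrite -ga_eq /sec; case: cid => b /= ->.
by split=> a; rewrite h.
Qed.

End Gluing.

(** * Transport of colorings and weights between two gluings *)

Lemma glue_transport m (L R Q : pretangle m) (D D' : pretangle 0) :
  rigid L -> simulates L R -> glues_to L Q D -> glues_to R Q D' ->
  exists2 F : Hom X D -> Hom X D', injective F & forall f, BW phi (F f) = BW phi f.
Proof.
move=> rigL simLR [gx [ga [gxb gao gae gas]]] [gx' [ga' [gxb' gao' gae' gas']]].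
(* Restrict the coloring to [L] and [Q], trade the [L] part for one on [R] with the same boundary
   and weight, and glue it to the unchanged [Q] part. *)
have H f : exists f' : Hom X D',
    (forall a, label f' (ga' (inr a)) = label f (ga (inr a))) /\ BW phi f' = BW phi f.
  have hf := label_coloring f; have [hL hQ] := (glue_coloring gxb gas _).1 hf.
  have [r [hr br wr]] := simLR _ hL.
  have brq : same_boundary r (fun a : semiarc Q => label f (ga (inr a))).
    by move=> i; rewrite -br; apply: (glue_boundary gae).
  have [l [lr lq]] := glue_extend gao' gae' brq.
  have hl : coloring l.
    apply/(glue_coloring gxb' gas').
    by under eq_fun do rewrite lr; under [X in _ /\ coloring X]eq_fun do rewrite lq.
  have [f' ef'] := coloring_label hl; exists f'; split=> [a|]; first by rewrite ef'.
  have {ef'}ef' : label f' = l by apply: funext.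
  rewrite !BWE ef' (glue_weight gxb' gas' hl) (glue_weight gxb gas hf) wr.
  have -> : (fun a => l (ga' (inl a))) = r by apply: funext.
  by have -> : (fun a => l (ga' (inr a))) = fun a => label f (ga (inr a)) by apply: funext.
have [F HF] := choice H; exists F => [f g Ffg|f]; last by case: (HF f).
(* Since [F] keeps the colors on [Q], equal images force agreement on [Q], hence on the boundary of
   [L]; rigidity then settles the semiarcs of [L]. *)
apply: label_inj => d; have [b <-] := gao d.
have eQ a : label f (ga (inr a)) = label g (ga (inr a)).
  by case: (HF f) (HF g) => <- _ [<- _]; rewrite Ffg.
case: b => // a; have [[hf _] [hg _]] :=
  ((glue_coloring gxb gas _).1 (label_coloring f), (glue_coloring gxb gas _).1 (label_coloring g)).
apply: (rigL _ _ hf hg) => i.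
by rewrite (glue_boundary gae) eQ -(glue_boundary gae).
Qed.

(** Both sets of homomorphisms are finite, so two opposite injections make [F] a bijection along
    which the sum and the multiset are reindexed. *)
Lemma Phi_transport (D D' : pretangle 0) (F : Hom X D -> Hom X D') (G : Hom X D' -> Hom X D) :
  injective F -> injective G -> (forall f, BW phi (F f) = BW phi f) ->
  Phi_multiset phi D = Phi_multiset phi D' /\ Phi_sum phi D = Phi_sum phi D'.
Proof.
move=> injF injG BWF.
have bijF : bijective F by apply: inj_card_bij injF (leq_card G injG).
split; last first.
  rewrite /Phi_sum (reindex F) /=; last exact: onW_bij.
  by apply: eq_bigr => f _; rewrite BWF.
apply/eq_seq_msetP.
have -> : [seq BW phi f | f : Hom X D] = map (@BW X A phi D') (map F (enum {: Hom X D})).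
  by rewrite -map_comp; apply: eq_map => f /=; rewrite BWF.
apply: perm_map; apply: uniq_perm; rewrite ?map_inj_uniq -?enumT ?enum_uniq //.
move=> f; rewrite mem_enum inE; have [G' _ FG] := bijF.
by apply/mapP; exists (G' f); rewrite ?mem_enum.
Qed.

(** * Reduction of concrete codes to equations between colors numbered in [nat] *)

Fixpoint pd_coloring (cs : seq (seq nat)) (u : nat -> X) : Prop :=
  if cs is c :: cs' then
    [/\ u (nth 0%N c 2) = under (u (nth 0%N c 0)) (u (nth 0%N c 3)),
        u (nth 0%N c 1) = over (u (nth 0%N c 3)) (u (nth 0%N c 0)) & pd_coloring cs' u]
  else True.

Fixpoint pd_weight (w : X -> X -> A) (cs : seq (seq nat)) (u : nat -> X) : A :=
  if cs is c :: cs' then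
    w (u (nth 0%N c 0)) (u (nth 0%N c 3)) + pd_weight w cs' u
  else 0.

(* [pd n cs bs] with its number [m = size bs] of loose ends as a parameter. *)
Definition pdm m n (cs : seq (seq nat)) (bs : seq nat) : pretangle m :=
  @Pretangle m 'I_n.+1 'I_(size cs)
    (fun c k => inord (nth 0%N (nth [::] cs c) k)) (fun i => inord (nth 0%N bs i)).

Lemma pdm_coloring m n cs bs (l : 'I_n.+1 -> X) :
  coloring (T := pdm m n cs bs) l <-> pd_coloring cs (fun i => l (inord i)).
Proof.
rewrite /coloring /crossing_rel /= !inordK //; elim: cs => [|c cs IHcs] /=.
  by split=> // _ [].
split=> [H|[H1 H2 /IHcs H] [[|i] hi]].
- by case: (H ord0) => H1 H2; split=> //; apply/IHcs => i; exact: (H (lift ord0 i)).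
- by [].
exact: (H (Ordinal (hi : (i < size cs)%N))).
Qed.

Lemma pdm_weight m n cs bs (l : 'I_n.+1 -> X) :
  weight (T := pdm m n cs bs) l = pd_weight (cochain2_fun phi) cs (fun i => l (inord i)).
Proof.
rewrite /weight /crossing_weight /= !inordK //; elim: cs => [|c cs IHcs] /=.
  by rewrite big_ord0.
by rewrite big_ord_recl /= -IHcs.
Qed.

(** Comparing lists of colors over [iota] lets simplification produce one equation per semiarc once
    the code is concrete. *)
Lemma pdm_rigid m n cs bs :
  (forall u v, pd_coloring cs u -> pd_coloring cs v ->
     [seq u (nth 0%N bs i) | i <- iota 0 m] = [seq v (nth 0%N bs i) | i <- iota 0 m] ->
     [seq u i | i <- iota 0 n.+1] = [seq v i | i <- iota 0 n.+1]) ->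
  rigid (pdm m n cs bs).
Proof.
move=> H l l' /pdm_coloring hl /pdm_coloring hl' ll' a.
have := H _ _ hl hl'.
have -> : [seq l (inord (nth 0%N bs i)) | i <- iota 0 m] =
          [seq l' (inord (nth 0%N bs i)) | i <- iota 0 m].
  apply/eq_in_map => i; rewrite mem_iota => /andP[_ hi]; exact: (ll' (Ordinal hi)).
move=> /(_ erefl) /eq_in_map /(_ (val a)).
by rewrite mem_iota ltn_ord inord_val; apply.
Qed.

(** The boolean premise keeps every semiarc number of the target in range, so [inord] does not alter
    it and a witness may be given as a function on [nat]. *)
Lemma pdm_simulates m n n' cs cs' bs bs' :
  all (all (gtn n'.+1)) cs' && all (gtn n'.+1) bs' ->
  (forall u, pd_coloring cs u -> exists v, [/\ pd_coloring cs' v,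
     [seq u (nth 0%N bs i) | i <- iota 0 m] = [seq v (nth 0%N bs' i) | i <- iota 0 m] &
     pd_weight (cochain2_fun phi) cs u = pd_weight (cochain2_fun phi) cs' v]) ->
  simulates (pdm m n cs bs) (pdm m n' cs' bs').
Proof.
move=> /andP[hcs hbs] H l /pdm_coloring /H [v [hv bv wv]].
have vE (s : seq nat) i : all (gtn n'.+1) s ->
    v (inord (nth 0%N s i) : 'I_n'.+1) = v (nth 0%N s i).
  move=> hs; rewrite inordK //; case: (ltnP i (size s)) => hi; last by rewrite nth_default.
  by have /allP := hs; apply; apply: mem_nth.
exists (fun a => v (val a)); split.
- apply/pdm_coloring; elim: cs' hcs hv {H bv wv} => //= c cs' IH /andP[hc hcs'] [h1 h2 h3].
  by rewrite /= !vE //; split=> //; apply: IH.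
- move=> i; rewrite /= vE //.
  by have /eq_in_map := bv; apply; rewrite mem_iota /=.
rewrite !pdm_weight wv.
elim: cs' hcs {H hv bv wv} => //= c cs' IH /andP[hc hcs'].
by rewrite !vE // IH.
Qed.

(** * Reidemeister I: the two kinks *)

Lemma R1_strand_rigid : rigid R1_strand.
Proof.
apply: (@pdm_rigid 2 0 _ [:: 0; 0]%N) => u v _ _ /= [e _]; by rewrite e.
Qed.

Lemma R1_kink_rigid : rigid R1_kink.
Proof.
apply: (@pdm_rigid 2 2 _ [:: 0; 2]%N) => u v /= [u2 u1 _] [v2 v1 _] [e0 e2].
(* The loop color occurs on both sides of its own relation. Solving for [w 0] and then applying
   [over_pairK] expresses the loop through the end color. *)
have diag (w : nat -> X) : w 1%N = over (w 0%N) (w 1%N) -> w 1%N = over (w 0%N) (w 0%N).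
  move=> w1; have -> : w 0%N = over (w 1%N) (w 1%N) by rewrite {1}w1 overK.
  by rewrite -[X in over _ X]bikei_diag over_pairK.
by rewrite (diag u) // (diag v) // e0 e2.
Qed.

Lemma R1_kink'_rigid : rigid R1_kink'.
Proof.
apply: (@pdm_rigid 2 2 _ [:: 0; 2]%N) => u v /= [u1 _ _] [v1 _ _] [e0 e2].
by rewrite u1 v1 e0 e2.
Qed.

Lemma R1_strand_kink : simulates R1_strand R1_kink.
Proof.
apply: (@pdm_simulates 2 0 2 _ _ [:: 0; 0]%N [:: 0; 2]%N) => // u _ /=.
set a := u 0%N; exists (nth a [:: a; over a a; a]); split=> //=.
  by rewrite -bikei_diag underK over_under bikei_diag.
by rewrite -bikei_diag phi_under phi_diag oppr0 addr0.
Qed.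

Lemma R1_kink_strand : simulates R1_kink R1_strand.
Proof.
apply: (@pdm_simulates 2 2 0 _ _ [:: 0; 2]%N [:: 0; 0]%N) => // u /= [u2 u1 _].
have u0 : u 0%N = over (u 1%N) (u 1%N) by rewrite {1}u1 overK.
exists (fun _ => u 0%N); split=> //=; first by rewrite u2 u0 under_over bikei_diag.
by rewrite u0 phi_over phi_diag oppr0 addr0.
Qed.

Lemma R1_strand_kink' : simulates R1_strand R1_kink'.
Proof.
apply: (@pdm_simulates 2 0 2 _ _ [:: 0; 0]%N [:: 0; 2]%N) => // u _ /=.
set a := u 0%N; exists (nth a [:: a; over a a; a]); split=> //=.
  by rewrite bikei_diag.
by rewrite phi_diag addr0.
Qed.

Lemma R1_kink'_strand : simulates R1_kink' R1_strand.
Proof.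
apply: (@pdm_simulates 2 2 0 _ _ [:: 0; 2]%N [:: 0; 0]%N) => // u /= [u1 u1' _].
have e : u 0%N = u 2%N.
  (* Both outputs of the crossing are the loop color, so the involution on pairs recovers the two
     ends from the loop alone, and [bikei_diag] equates them. *)
  rewrite -[LHS](under_pairK (u 0%N) (u 2%N)) -[RHS](over_pairK (u 0%N) (u 2%N)).
  by rewrite -u1 -u1' bikei_diag.
exists (fun _ => u 0%N); split=> //=; first by rewrite e.
by rewrite e phi_diag addr0.
Qed.

(** * Reidemeister II: the bigon *)

Lemma R2_parallel_rigid : rigid R2_parallel.
Proof.
by apply: (@pdm_rigid 4 1 _ [:: 0; 0; 1; 1]%N) => u v _ _ /= [e0 _ e1 _]; rewrite e0 e1.
Qed.

Lemma R2_bigon_rigid : rigid R2_bigon.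
Proof.
apply: (@pdm_rigid 4 5 _ [:: 0; 2; 3; 5]%N) => u v /= [_ _ [u5 u1 _]] [_ _ [v5 v1 _]].
(* Arc 4 lies inside the bigon; the action of arc 2, being an involution, recovers it from arc 5. *)
move=> [e0 e2 e3 e5]; have e4 : u 4%N = v 4%N.
  by rewrite -(underK (u 4%N) (u 2%N)) -(underK (v 4%N) (v 2%N)) -u5 -v5 e5 e2.
by rewrite u1 v1 e0 e2 e3 e4 e5.
Qed.

Lemma R2_parallel_bigon : simulates R2_parallel R2_bigon.
Proof.
apply: (@pdm_simulates 4 1 5 _ _ [:: 0; 0; 1; 1]%N [:: 0; 2; 3; 5]%N) => // u _ /=.
set a := u 0%N; set d := u 1%N.
(* The color of arc 4 solves [d = under _ a]; the upper crossing then fixes arc 1. *)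
exists (nth a [:: a; over a (under d a); a; d; under d a; d]); split=> //=.
  by rewrite under_over overK underK.
(* Both crossings have under color [under d a], and their over colors differ by its action, so the
   weights cancel. *)
by rewrite phi_over addr0 addNr.
Qed.

Lemma R2_bigon_parallel : simulates R2_bigon R2_parallel.
Proof.
apply: (@pdm_simulates 4 5 1 _ _ [:: 0; 2; 3; 5]%N [:: 0; 0; 1; 1]%N) => // u /=.
move=> [u3 u0 [u5 u1 _]]; exists (nth (u 0%N) [:: u 0%N; u 3%N]); split=> //=.
  by rewrite u0 u3 u5 u1 overK under_over.
by rewrite u1 phi_over addr0 addNr.
Qed.

(** * Reidemeister III, for both crossings of the lower strands *)

Hypothesis phi_cocycle : cocycle phi.

Lemma R3_above_rigid : rigid R3_above.
Proof.
apply: (@pdm_rigid 6 8 _ R3_ends) => u v /= [_ _ [u7 _ [u4 u1 _]]] [_ _ [v7 _ [v4 v1 _]]].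
by case=> e2 e5 e8 e0 e3 e6; rewrite u7 u4 u1 v7 v4 v1 e0 e2 e3 e5 e6 e8.
Qed.

Lemma R3_below_rigid : rigid R3_below.
Proof.
apply: (@pdm_rigid 6 8 _ R3_ends) => u v /= [u7 u4 [_ _ [_ u1 _]]] [v7 v4 [_ _ [_ v1 _]]].
by case=> e2 e5 e8 e0 e3 e6; rewrite u1 u7 u4 v1 v7 v4 e0 e2 e3 e5 e6 e8.
Qed.

Lemma R3_above'_rigid : rigid R3_above'.
Proof.
apply: (@pdm_rigid 6 8 _ R3_ends) => u v /= [_ _ [u7 _ [u4 u1 _]]] [_ _ [v7 _ [v4 v1 _]]].
by case=> e2 e5 e8 e0 e3 e6; rewrite u7 u4 u1 v7 v4 v1 e0 e2 e3 e5 e6 e8.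
Qed.

Lemma R3_below'_rigid : rigid R3_below'.
Proof.
apply: (@pdm_rigid 6 8 _ R3_ends) => u v /= [u5 u7 [_ _ [_ u1 _]]] [v5 v7 [_ _ [_ v1 _]]].
have [u4 u8] := crossing_half_turn u5 u7; have [v4 v8] := crossing_half_turn v5 v7.
case=> e2 e5 e8 e0 e3 e6.
have e4 : u 4%N = v 4%N by rewrite -(underK (u 4%N) (u 8%N)) -u5 e5 v5 e8 underK.
by rewrite u1 u7 v1 v7 e0 e2 e3 e4 e5 e6 e8.
Qed.

Lemma R3_above_below : simulates R3_above R3_below.
Proof.
apply: (@pdm_simulates 6 8 8 _ _ R3_ends R3_ends) => // u.
move: (cochain2_fun phi) (phi_R3 phi_cocycle) => w w_R3 /=.
move=> [u6 u3 [u7 u0 [u4 u1 _]]].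
(* These colors enter at arcs 2, 5 and 8. The witness keeps the boundary colors and gives the inner
   arcs 1, 4, 7 the colors that [R3_below] forces; the [swap] lemmas check the remaining
   relations. *)
set z := u 2%N; set y := u 5%N; set x := u 8%N.
exists (nth z [:: u 0%N; over z (under x y); z; u 3%N; over y x; y; u 6%N; under x y; x]).
split=> [|//|] /=.
  by rewrite u0 u3 u6 u7 u4 u1 over_over_swap over_under_swap under_under_swap.
rewrite u7 u4 u1 !addr0 !addrA; exact: w_R3.
Qed.

Lemma R3_below_above : simulates R3_below R3_above.
Proof.
apply: (@pdm_simulates 6 8 8 _ _ R3_ends R3_ends) => // u.
move: (cochain2_fun phi) (phi_R3 phi_cocycle) => w w_R3 /=.
move=> [u7 u4 [u3 u0 [u6 u1 _]]].
set z := u 2%N; set y := u 5%N; set x := u 8%N.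
exists (nth z [:: u 0%N; over z y; z; u 3%N; under y z; y; u 6%N; under x (over z y); x]).
split=> [|//|] /=.
  by rewrite u0 u3 u6 u1 u7 u4 over_over_swap over_under_swap under_under_swap.
rewrite u1 u7 u4 !addr0 !addrA; exact/esym/w_R3.
Qed.

Lemma R3_above'_below' : simulates R3_above' R3_below'.
Proof.
apply: (@pdm_simulates 6 8 8 _ _ R3_ends R3_ends) => // u.
move: (cochain2_fun phi) (phi_R3' phi_cocycle) => w w_R3 /=.
move=> [u4' u6 [u7 u0 [u4 u1 _]]].
(* The crossing of the lower strands is read from arc 3, an outgoing end; inverting it expresses
   arcs 3 and 6 through arcs 4 and 7. *)
have u3 : u 3%N = under (u 4%N) (u 7%N) by rewrite u4' underK.
have {}u6 : u 6%N = over (u 7%N) (u 4%N) by rewrite u6 u3 over_under.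
set z := u 2%N; set y := u 5%N; set x := u 8%N.
exists (nth z [:: u 0%N; over z (over x y); z; u 3%N; under y x; y; u 6%N; over x y; x]).
split=> [|//|] /=.
  rewrite u0 u3 u6 u7 u4 u1 over_over_swap' under_under_swap' over_under_swap'.
  by rewrite underK over_under.
rewrite u3 u7 u4 u1 !addr0 !addrA; exact: w_R3.
Qed.

Lemma R3_below'_above' : simulates R3_below' R3_above'.
Proof.
apply: (@pdm_simulates 6 8 8 _ _ R3_ends R3_ends) => // u.
move: (cochain2_fun phi) (phi_R3' phi_cocycle) => w w_R3 /=.
move=> [u5 u7' [u3 u0 [u6 u1 _]]].
have u4 : u 4%N = under (u 5%N) (u 8%N) by rewrite u5 underK.
have u7 : u 7%N = over (u 8%N) (u 5%N) by rewrite u7' u4 over_under.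
set z := u 2%N; set y := u 5%N; set x := u 8%N.
exists (nth z [:: u 0%N; over z y; z; u 3%N; under y z; y; u 6%N; under x (over z y); x]).
split=> [|//|] /=.
  rewrite u0 u3 u6 u1 u7 u4 over_over_swap' -under_under_swap' -over_under_swap'.
  by rewrite underK over_under.
rewrite u3 u1 u7 u4 !addr0 !addrA -under_under_swap'; exact/esym/w_R3.
Qed.

(** * Invariance under every move *)

Lemma local_move_simulates m (L R : pretangle m) : local_move L R ->
  [/\ rigid L, rigid R, simulates L R & simulates R L].
Proof.
case.
- have r : rigid empty_tangle by move=> l l' _ _ _ [].
  have s : simulates empty_tangle empty_tangle by move=> l hl; exists l.
  by split.
- split; [exact: R1_strand_rigid|exact: R1_kink_rigid
         |exact: R1_strand_kink|exact: R1_kink_strand].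
- split; [exact: R1_strand_rigid|exact: R1_kink'_rigid
         |exact: R1_strand_kink'|exact: R1_kink'_strand].
- split; [exact: R2_parallel_rigid|exact: R2_bigon_rigid
         |exact: R2_parallel_bigon|exact: R2_bigon_parallel].
- split; [exact: R3_above_rigid|exact: R3_below_rigid
         |exact: R3_above_below|exact: R3_below_above].
- split; [exact: R3_above'_rigid|exact: R3_below'_rigid
         |exact: R3_above'_below'|exact: R3_below'_above'].
Qed.

Lemma reidemeister_move_Phi (D D' : link_diagram) : reidemeister_move D D' ->
  Phi_multiset phi D = Phi_multiset phi D' /\ Phi_sum phi D = Phi_sum phi D'.
Proof.
case=> m [L [R [Q [/local_move_simulates[rL rR sLR sRL] _ gD gD']]]].
have [F injF BWF] := glue_transport rL sLR gD gD'.
have [G injG _] := glue_transport rR sRL gD' gD.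
exact: Phi_transport injF injG BWF.
Qed.

End Colorings.

Theorem theorem5 (X : finBikeiType) (A : zmodType)
    (h : cohomology X A 2) (phi : cochain X A 2) (hphi : represents phi h)
    (D D' : link_diagram) (hDD' : reidemeister_equivalent D D') :
  Phi_multiset phi D = Phi_multiset phi D' /\
  Phi_sum phi D = Phi_sum phi D'.
Proof.
have phi_cocycle := represents_cocycle hphi.
elim: hDD' => [E E'|E|E E' _ [-> ->]|E E' E'' _ [-> ->] _ [-> ->]] //.
exact: reidemeister_move_Phi.
Qed.
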